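(* Let $p=p_n$ possibly depend on $n$. Suppose that the following hold. (A1) The errors $\varepsilon_1,\dots,\varepsilon_n$ are independent and identically distributed, have $0$ as their $\tau$-th expectile (i.e. $\mathbb{E}[g_\tau(\varepsilon_i)]=0$), have a positive density which is continuous near $0$, and $\mathbb{E}(\varepsilon_i^4)<\infty$. (A2) There is a constant $C_0>0$ with $\max_{1\le i\le n}\|\mathbb{X}_i\|_\infty\le C_0$. (A3) There are constants $0<m_0\le M_0<\infty$ such that $m_0\le\delta_{\min}(\Upsilon_n)\le\delta_{\max}(\Upsilon_n)\le M_0$, where $\Upsilon_n=n^{-1}\sum_{i=1}^n\mathbb{X}_i\mathbb{X}_i^\top$. (A4) $p=O(n^c)$ with $c\in[0,1/2)$. (A5) With $h_0=\min_{1\le j\le p^0}\|\beta_j^0\|_2$, there exist a constant $K>0$ and a real $\alpha>(c-1)/2$ such that $K\le n^{-\alpha}h_0$. Suppose also that $\lambda_n\to0$ and $\lambda_n n^{1/2-\alpha\gamma}\to0$ as $n\to\infty$. Then $$\|\widehat{\beta}_n-\beta^0\|_2=O_{\mathbb{P}}\big((p/n)^{1/2}\big).$$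
   Context: Model: for $i=1,\dots,n$, $Y_i=\sum_{j=1}^p\mathbf{X}_{ij}^\top\beta_j^0+\varepsilon_i=\mathbb{X}_i^\top\beta^0+\varepsilon_i$, where for each group $j\in\{1,\dots,p\}$ the deterministic design vector $\mathbf{X}_{ij}$ and the true (unknown) parameter $\beta_j^0$ lie in $\mathbb{R}^{d_j}$, $\mathbb{X}_i=(\mathbf{X}_{i1},\dots,\mathbf{X}_{ip})\in\mathbb{R}^r$, $\beta^0=(\beta_1^0,\dots,\beta_p^0)\in\mathbb{R}^r$, $r=\sum_{j=1}^p d_j$, and $\varepsilon_i$ is a random error. Any $\beta\in\mathbb{R}^r$ is written $\beta=(\beta_1,\dots,\beta_p)$ with $\beta_j\in\mathbb{R}^{d_j}$. It is assumed that $\|\beta_j^0\|_2\ne0$ for $j\le p^0$ and $\|\beta_j^0\|_2=0$ for $j>p^0$, where $p^0\le p$ is unknown. The quantities $p$, $p^0$, $r$, $\beta^0$ and the design may depend on $n$ (the dependence is not displayed); the constants in the assumptions do not depend on $n$. For a fixed $\tau\in(0,1)$: $\rho_\tau(u)=u^2\,|\tau-\mathbb{1}_{u<0}|$ and $g_\tau(\varepsilon)=-2\varepsilon(\tau\mathbb{1}_{\varepsilon\ge0}+(1-\tau)\mathbb{1}_{\varepsilon<0})$. Expectile estimator: $\widetilde{\beta}_n=(\widetilde{\beta}_{n;1},\dots,\widetilde{\beta}_{n;p})=\arg\min_{\beta\in\mathbb{R}^r}\sum_{i=1}^n\rho_\tau(Y_i-\mathbb{X}_i^\top\beta)$. Adaptive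 group LASSO expectile estimator: $\widehat{\beta}_n=\arg\min_{\beta\in\mathbb{R}^r}\big\{n^{-1}\sum_{i=1}^n\rho_\tau(Y_i-\mathbb{X}_i^\top\beta)+\lambda_n\sum_{j=1}^p\widehat{\omega}_{n;j}\|\beta_j\|_2\big\}$, with weights $\widehat{\omega}_{n;j}=\|\widetilde{\beta}_{n;j}\|_2^{-\gamma}$, where $\gamma>0$ is a known constant and $(\lambda_n)$ is a sequence of positive tuning parameters. $\delta_{\min},\delta_{\max}$ denote smallest and largest eigenvalues; $\|\cdot\|_2$, $\|\cdot\|_\infty$ are the Euclidean and sup norms. $V_n=O_{\mathbb{P}}(U_n)$ means: for every $e>0$ there is $C>0$ such that $\mathbb{P}(|V_n|>C|U_n|)<e$ for all large $n$.
   Formalization: The formal theorem additionally assumes r = O(p), i.e. group sizes d_j bounded on average; without it the claim fails (e.g. d_j = j, p of order n^0.4, negligible λ_n, where the error is of order (r/n)^{1/2}). *)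

(* Defs.v *)
From HB Require Import structures.
From mathcomp Require Import all_boot all_order all_algebra.
From mathcomp Require Import all_classical all_reals all_analysis.

Set Implicit Arguments.
Unset Strict Implicit.
Unset Printing Implicit Defensive.

Import Order.TTheory GRing.Theory Num.Theory.
Import numFieldNormedType.Exports.

Local Open Scope classical_set_scope.
Local Open Scope ring_scope.

(* [`|v|] is the sup norm of matrices, hence a separate Euclidean norm. *)
Definition norm2 (R : realType) (m : nat) (v : 'cV[R]_m) : R :=
  Num.sqrt (\sum_(i < m) v i 0 ^+ 2).

(* Meant for symmetric A, whose spectrum is real, with m > 0; both are 0 when
   m = 0, the spectrum being then empty. *)
Definition delta_min (R : realType) (m : nat) (A : 'M[R]_m) : R :=
  inf [set a | eigenvalue A a].

Definition delta_max (R : realType) (m : nat) (A : 'M[R]_m) : R :=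
  sup [set a | eigenvalue A a].

Definition is_argmin {disp : Order.disp_t} {V : porderType disp} {U : Type}
    (f : U -> V) (x : U) : Prop :=
  forall y, (f x <= f y)%O.

Section probability.
Context {d : measure_display} {T : measurableType d} {R : realType}.
Variable P : probability T R.

Definition mutually_independent (X : nat -> {RV P >-> R}) : Prop :=
  forall (J : seq nat) (A : nat -> set R), uniq J ->
    (forall i, measurable (A i)) ->
    (P (\big[setI/setT]_(i <- J) (X i @^-1` A i)) =
     \prod_(i <- J) P (X i @^-1` A i))%E.

Definition identically_distributed (X : nat -> {RV P >-> R}) : Prop :=
  forall i j (A : set R), measurable A ->
    distribution P (X i) A = distribution P (X j) A.

Definition has_density (X : {RV P >-> R}) (f : R -> R) : Prop :=
  [/\ measurable_fun setT f, forall x, 0 <= f x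
    & forall A : set R, measurable A ->
        (distribution P X A = \int[lebesgue_measure]_(x in A) (f x)%:E)%E].

Definition stochastic_bigO (V : nat -> T -> R) (U : nat -> R) : Prop :=
  forall e : R, 0 < e -> exists2 C : R, 0 < C &
    \forall n \near \oo,
      (P [set w | (C * `|U n| < `|V n w|)%R] < e%:E)%E.

End probability.

Section expectile.
Context {R : realType}.
Variable tau : R.

Definition rho_tau (u : R) : R := u ^+ 2 * `|tau - (u < 0)%R%:R|.

Definition g_tau (e : R) : R :=
  - 2 * e * (tau * (0 <= e)%R%:R + (1 - tau) * (e < 0)%R%:R).

(* The rows of X are the design vectors; a coefficient vector is a block column
   whose j-th block [submxcol b j] has size q j. *)
Context {n p : nat} {q : 'I_p -> nat}.
Variables (X : 'M[R]_(n, \sum_(j < p) q j)) (Y : 'cV[R]_n).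

Definition expectile_loss (b : 'cV[R]_(\sum_(j < p) q j)) : R :=
  \sum_(i < n) rho_tau (Y i 0 - (X *m b) i 0).

Definition gram : 'M[R]_(\sum_(j < p) q j) := n%:R^-1 *: (X^T *m X).

(* x ^ (- gamma) for x >= 0 and gamma > 0.  [powR] has 0 `^ (- gamma) = 0, while
   a group estimated as null must get an infinite weight. *)
Definition adaptive_weight (gamma x : R) : \bar R :=
  if x == 0 then +oo%E else (x `^ (- gamma))%:E.

(* Since +oo * 0 = 0 in \bar R, an infinite weight forces the group to vanish
   at any point where the objective is finite. *)
Definition adaptive_objective (gamma lambda : R)
    (btilde b : 'cV[R]_(\sum_(j < p) q j)) : \bar R :=
  ((n%:R^-1 * expectile_loss b)%:E +
   lambda%:E * \sum_(j < p)
     adaptive_weight gamma (norm2 (submxcol btilde j)) * (norm2 (submxcol b j))%:E)%E.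

(* Groups are numbered from 0; the minimum over no group is +oo. *)
Definition min_signal (p0 : nat) (b : 'cV[R]_(\sum_(j < p) q j)) : \bar R :=
  \big[Order.min/+oo%E]_(j < p | (j < p0)%N) (norm2 (submxcol b j))%:E.

End expectile.

(* Main.v *)
Require Import Defs.
From HB Require Import structures.
From mathcomp Require Import all_boot all_order all_algebra.
From mathcomp Require Import all_classical all_reals all_analysis.
From mathcomp Require Import measurable_realfun.
From mathcomp Require Import ring lra.

Set Implicit Arguments.
Unset Strict Implicit.
Unset Printing Implicit Defensive.

Import Order.TTheory GRing.Theory Num.Theory.
Import numFieldNormedType.Exports.

Local Open Scope classical_set_scope.
Local Open Scope ring_scope.

(* The asymmetric square loss is strongly convex with modulus
   kappa = min tau (1 - tau), so by (A3) the loss at b exceeds the loss at the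
   true parameter by at least kappa m0 n |b - beta0|^2 - |S| |b - beta0|, where
   S = X^T g_tau(eps).  The coordinates of g_tau(eps) are centred, independent
   and square integrable, hence E |S|^2 = O(n r) = O(n p), and Markov's
   inequality gives |S| = O_P(sqrt (n p)).  On the event |S|^2 <= A n p the
   expectile estimator is at distance O(sqrt (p / n)) = o(n^alpha) of beta0, so
   that the weights of the active groups are O(n^(- alpha gamma)); comparing the
   penalized objective at the estimator and at beta0 then costs a penalty of
   O(lambda n^(- alpha gamma) sqrt p |b - beta0|) = o(sqrt (p / n) |b - beta0|). *)

(** * Quadratic forms and the smallest eigenvalue *)

Section quadratic_forms.
Context {R : realType}.

Definition dotv (m : nat) (u v : 'cV[R]_m) : R := (u^T *m v) 0 0.

Lemma dotvE m (u v : 'cV[R]_m) : dotv u v = \sum_i u i 0 * v i 0.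
Proof. by rewrite /dotv mxE; apply: eq_bigr => i _; rewrite mxE. Qed.

Lemma dotvC m (u v : 'cV[R]_m) : dotv u v = dotv v u.
Proof. by rewrite !dotvE; apply: eq_bigr => i _; rewrite mulrC. Qed.

Lemma dotvDl m (u v w : 'cV[R]_m) : dotv (u + v) w = dotv u w + dotv v w.
Proof. by rewrite /dotv linearD mulmxDl mxE. Qed.

Lemma dotvDr m (u v w : 'cV[R]_m) : dotv w (u + v) = dotv w u + dotv w v.
Proof. by rewrite /dotv mulmxDr mxE. Qed.

Lemma dotvZl m a (u w : 'cV[R]_m) : dotv (a *: u) w = a * dotv u w.
Proof. by rewrite /dotv linearZ -scalemxAl mxE. Qed.

Lemma dotvZr m a (u w : 'cV[R]_m) : dotv w (a *: u) = a * dotv w u.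
Proof. by rewrite /dotv -scalemxAr mxE. Qed.

Lemma dotv_mull m n (A : 'M[R]_(m, n)) u v : dotv (A *m u) v = dotv u (A^T *m v).
Proof. by rewrite /dotv trmx_mul mulmxA. Qed.

Lemma dotv_ge0 m (u : 'cV[R]_m) : 0 <= dotv u u.
Proof. by rewrite dotvE sumr_ge0 // => i _; rewrite -expr2 sqr_ge0. Qed.

Lemma dotv_gt0 m (u : 'cV[R]_m) : u != 0 -> 0 < dotv u u.
Proof.
move=> u0; rewrite lt_neqAle dotv_ge0 andbT eq_sym.
apply: contraNneq u0 => /eqP; rewrite dotvE psumr_eq0; last first.
  by move=> i _; rewrite -expr2 sqr_ge0.
move/allP => u0; apply/eqP/matrixP => i j; rewrite (ord1 j) mxE.
by have := u0 i (mem_index_enum i); rewrite /= mulf_eq0 orbb => /eqP.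
Qed.

Lemma norm2_ge0 m (v : 'cV[R]_m) : 0 <= norm2 v.
Proof. exact: sqrtr_ge0. Qed.

Lemma sqr_norm2 m (v : 'cV[R]_m) : norm2 v ^+ 2 = dotv v v.
Proof.
rewrite sqr_sqrtr ?dotvE; last by rewrite sumr_ge0 // => i _; rewrite sqr_ge0.
by apply: eq_bigr => i _; rewrite expr2.
Qed.

(** The discriminant criterion. The polynomial only needs degree at most 2, so the degenerate case
    [a = 0] is included. *)
Lemma sqr_le_of_quadratic_ge0 (a b c : R) :
  (forall t, 0 <= a * t ^+ 2 + 2 * b * t + c) -> b ^+ 2 <= a * c.
Proof.
move=> h; pose p := Poly [:: c; 2 * b; a].
have := @deg_le2_poly_ge0 R p; rewrite size_Poly// !coef_Poly/=.
move=> /(_ isT) hp.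
suff : (2 * b) ^+ 2 - 4 * a * c <= 0 by nra.
apply: hp => t; rewrite horner_Poly/=.
by have := h t; congr (_ <= _); ring.
Qed.

(** Expand the form at [t *: u + v] and take the discriminant in [t]. Semidefinite forms must be
    allowed: the lemma is applied to a form whose Rayleigh quotients have infimum 0. *)
Lemma psd_cauchy_schwarz m (A : 'M[R]_m) (u v : 'cV[R]_m) :
  A^T = A -> (forall w, 0 <= dotv w (A *m w)) ->
  dotv u (A *m v) ^+ 2 <= dotv u (A *m u) * dotv v (A *m v).
Proof.
move=> As A0; apply: sqr_le_of_quadratic_ge0 => t.
have := A0 (t *: u + v).
rewrite mulmxDr -scalemxAr !(dotvDl, dotvDr, dotvZl, dotvZr).
rewrite (dotvC v (A *m u)) dotv_mull As.
by congr (_ <= _); ring.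
Qed.

Lemma cauchy_schwarz_dotv m (u v : 'cV[R]_m) : dotv u v <= norm2 u * norm2 v.
Proof.
have h := @psd_cauchy_schwarz m 1%:M u v.
rewrite (le_trans (ler_norm _))// -ler_sqr ?nnegrE ?mulr_ge0 ?norm2_ge0//.
rewrite real_normK ?num_real// exprMn !sqr_norm2.
by move: h; rewrite !mul1mx tr_scalar_mx; apply => // w; rewrite mul1mx dotv_ge0.
Qed.

Lemma sqr_sum_le (I : finType) (P : pred I) (a : I -> R) :
  (\sum_(i | P i) a i) ^+ 2 <= #|P|%:R * \sum_(i | P i) a i ^+ 2.
Proof.
apply: sqr_le_of_quadratic_ge0 => t.
have -> : #|P|%:R * t ^+ 2 + 2 * (\sum_(i | P i) a i) * t + \sum_(i | P i) a i ^+ 2 =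
    \sum_(i | P i) (t + a i) ^+ 2.
  rewrite -sumr_const mulr_suml mulr_sumr mulr_suml -!big_split/=.
  by apply: eq_bigr => i _; ring.
by apply: sumr_ge0 => i _; rewrite sqr_ge0.
Qed.

(** A crude bound by the entries is enough, since a product of two coordinates never exceeds
    [dotv v v] in absolute value. The summand 1 keeps [K] positive even for a null matrix, so that
    [K^-1] is a genuine gap below. *)
Lemma dotv_mul_bounded m (A : 'M[R]_m) :
  exists2 K, 0 < K & forall v, dotv v (A *m v) <= K * dotv v v.
Proof.
exists (1 + \sum_i \sum_j `|A i j|) => [|v].
  by rewrite ltr_pwDl// sumr_ge0 // => i _; rewrite sumr_ge0.
rewrite mulrDl mul1r ler_wpDl ?dotv_ge0// [leLHS]dotvE mulr_suml.
apply: ler_sum => i _; rewrite mxE mulr_sumr mulr_suml.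
apply: ler_sum => j _; apply: (le_trans (ler_norm _)).
rewrite mulrCA normrM; apply: ler_wpM2l => //; rewrite normrM.
have sq k : `|v k 0| ^+ 2 <= dotv v v.
  rewrite dotvE (bigD1 k)//= real_normK ?num_real// expr2 lerDl.
  by rewrite sumr_ge0 // => l _; rewrite -expr2 sqr_ge0.
have := sq i; have := sq j; have := sqr_ge0 (`|v i 0| - `|v j 0|); nra.
Qed.

(** No diagonalisation is used: the infimum [mu] of the Rayleigh quotients is shown to be an
    eigenvalue, so the infimum of all eigenvalues is at most [mu]. *)
Lemma delta_min_dotv m (A : 'M[R]_m) (v : 'cV[R]_m) :
  A^T = A -> (forall w, 0 <= dotv w (A *m w)) ->
  delta_min A * dotv v v <= dotv v (A *m v).
Proof.
move=> As A0; have [->|v0] := eqVneq v 0.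
  by rewrite mulmx0 /dotv mulmx0 mxE mulr0.
pose S := [set dotv u (A *m u) / dotv u u | u in [set u | u != 0]].
pose mu := inf S.
have S0 : S !=set0 by exists (dotv v (A *m v) / dotv v v), v.
have Slb : has_lbound S.
  by exists 0 => _ [u u0 <-]; rewrite divr_ge0 ?dotv_ge0.
have mule u : mu * dotv u u <= dotv u (A *m u).
  have [->|u0] := eqVneq u 0; first by rewrite mulmx0 /dotv mulmx0 mxE mulr0.
  by rewrite -ler_pdivlMr ?dotv_gt0//; apply: ge_inf => //; exists u.
apply: le_trans (mule v); rewrite ler_wpM2r ?dotv_ge0//.
apply: ge_inf.
  (* The spectrum must be bounded below for its infimum to be a lower bound; [mu] is one, each
     eigenvalue being the Rayleigh quotient of its eigenvector. Eigenvectors are rows here, hence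
     the transposes. *)
  exists mu => a /eigenvalueP[u uA u0].
  have uT0 : u^T != 0 by rewrite trmx_eq0.
  have := mule u^T.
  have -> : A *m u^T = a *: u^T by rewrite -{1}As -trmx_mul uA linearZ.
  by rewrite dotvZr ler_pM2r// dotv_gt0.
(* mu is attained: were A - mu invertible, Cauchy-Schwarz for this form would
   bound all Rayleigh quotients below by mu + 1 / K. *)
rewrite /= /eigenvalue /eigenspace kermx_eq0 row_free_unit.
apply/negP => Bu; pose B := A - mu%:M.
have BE w : dotv w (B *m w) = dotv w (A *m w) - mu * dotv w w.
  by rewrite mulmxBl mul_scalar_mx -scaleNr dotvDr dotvZr mulNr.
have Bs : B^T = B by rewrite linearB/= tr_scalar_mx As.
have B0 w : 0 <= dotv w (B *m w) by rewrite BE subr_ge0.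
have [K K0 hK] := dotv_mul_bounded (invmx B).
have hB w : w != 0 -> mu + K^-1 <= dotv w (A *m w) / dotv w w.
  move=> w0; have ww := dotv_gt0 w0.
  (* With this second vector the left side is [dotv w w ^+ 2], while the last factor is at most
     [K * dotv w w]; hence [dotv w (B *m w)] is at least [K^-1 * dotv w w]. *)
  have := psd_cauchy_schwarz w (invmx B *m w) Bs B0.
  rewrite (mulKVmx Bu) dotvC (dotvC (invmx B *m w)) => h.
  have h' := hK w.
  rewrite ler_pdivlMr// mulrDl -lerBrDl -BE -(ler_pM2l K0) mulrA.
  rewrite mulfV ?gt_eqF// mul1r -(ler_pM2r ww) -expr2.
  apply: le_trans h _; rewrite (dotvC (B *m w)) (mulrC K) -mulrA; exact: ler_wpM2l.
have : mu + K^-1 <= mu by apply: lb_le_inf => // _ [w w0 <-]; exact: hB.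
by rewrite gerDl leNgt invr_gt0 K0.
Qed.

End quadratic_forms.

(** * Growth of the expectile loss and the penalty *)

Section loss.
Context {R : realType}.

Lemma norm2_triangle m (u v : 'cV[R]_m) : norm2 (u + v) <= norm2 u + norm2 v.
Proof.
rewrite -ler_sqr ?nnegrE ?addr_ge0 ?norm2_ge0// sqrrD !sqr_norm2.
rewrite dotvDl !dotvDr (dotvC v u).
by have := cauchy_schwarz_dotv u v; lra.
Qed.

Lemma norm2N m (u : 'cV[R]_m) : norm2 (- u) = norm2 u.
Proof. by rewrite /norm2; congr Num.sqrt; apply: eq_bigr => i _; rewrite mxE sqrrN. Qed.

Lemma norm2_sub_le m (u v : 'cV[R]_m) : norm2 u - norm2 v <= norm2 (v - u).
Proof.
rewrite -(norm2N (v - u)) opprB lerBlDr; apply: le_trans (norm2_triangle _ _).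
by rewrite subrK.
Qed.

Lemma sum_sqr_norm2_submxcol p (q : 'I_p -> nat) (v : 'cV[R]_(\sum_(j < p) q j)) :
  \sum_j norm2 (submxcol v j) ^+ 2 = norm2 v ^+ 2.
Proof.
rewrite sqr_norm2 /dotv -{2 3}(submxcolK v) tr_mxcol mul_mxrow_mxcol summxE.
by apply: eq_bigr => j _; rewrite sqr_norm2.
Qed.

Lemma norm2_submxcol_le p (q : 'I_p -> nat) (v : 'cV[R]_(\sum_(j < p) q j)) j :
  norm2 (submxcol v j) <= norm2 v.
Proof.
rewrite -ler_sqr ?nnegrE ?norm2_ge0// -[leRHS]sum_sqr_norm2_submxcol.
by rewrite (bigD1 j)//= lerDl sumr_ge0 // => i _; rewrite sqr_ge0.
Qed.

(** Cauchy-Schwarz over the groups, the number of selected groups being at most [p]. This is where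
    the factor [sqrt p] of the penalty comes from. *)
Lemma sum_norm2_submxcol_le p (q : 'I_p -> nat) (A : pred 'I_p)
    (v : 'cV[R]_(\sum_(j < p) q j)) :
  \sum_(j | A j) norm2 (submxcol v j) <= Num.sqrt p%:R * norm2 v.
Proof.
rewrite -ler_sqr ?nnegrE ?mulr_ge0 ?norm2_ge0 ?sqrtr_ge0 ?sumr_ge0//; last first.
  by move=> j _; exact: norm2_ge0.
apply: le_trans (sqr_sum_le _ _) _.
rewrite exprMn sqr_sqrtr// -sum_sqr_norm2_submxcol ler_pM//.
- by rewrite sumr_ge0 // => j _; rewrite sqr_ge0.
- by rewrite ler_nat -[leqRHS]card_ord max_card.
rewrite [leRHS](bigID A)/= lerDl sumr_ge0 // => j _; exact: sqr_ge0.
Qed.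

Variables (tau kappa : R).
Hypotheses (htau : 0 < tau < 1) (kappa_le : kappa <= tau) (kappa_le' : kappa <= 1 - tau).

(** Strong convexity: [g_tau] is minus the derivative of [rho_tau], hence the slope at 0 of
    [v -> rho_tau (u - v)]. *)
Lemma rho_tau_convex (u v : R) :
  rho_tau tau u + g_tau tau u * v + kappa * v ^+ 2 <= rho_tau tau (u - v).
Proof.
have /andP[t0 t1] := htau.
have e0 : `|tau - 0%:R| = tau by rewrite subr0 gtr0_norm.
have e1 : `|tau - 1%:R| = 1 - tau by rewrite distrC gtr0_norm// subr_gt0.
(* In terms of the new residual [w], the claim is a polynomial inequality on each sign pattern of
   [u] and [w]. When the signs differ, [u * w <= 0] is the extra information needed. *)
have [w -> {v}] : exists w, v = u - w by exists (u - v); ring.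
rewrite /rho_tau /g_tau subKr.
have k0 : 0 <= tau - kappa by rewrite subr_ge0.
have k1 : 0 <= 1 - tau - kappa by rewrite subr_ge0.
have sqw := sqr_ge0 w; have squ := sqr_ge0 (u - w).
case: (ltP u 0) => u0; case: (ltP w 0) => w0; rewrite ?e0 ?e1 /=.
- by have := mulr_ge0 k1 squ; lra.
- have uw : 0 <= u ^+ 2 - 2 * (u * w) by have := sqr_ge0 u; nra.
  by have := mulr_ge0 k1 uw; have := mulr_ge0 k0 sqw; lra.
- have uw : 0 <= u ^+ 2 - 2 * (u * w) by have := sqr_ge0 u; nra.
  by have := mulr_ge0 k0 uw; have := mulr_ge0 k1 sqw; lra.
- by have := mulr_ge0 k0 squ; lra.
Qed.

Section design.
Context {n p : nat} {q : 'I_p -> nat}.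
Variables (X : 'M[R]_(n, \sum_(j < p) q j)) (Y : 'cV[R]_n).
Variables (m0 : R) (b0 : 'cV[R]_(\sum_(j < p) q j)).

(** The gradient of the expectile loss at [b0]. *)
Definition score : 'cV[R]_(\sum_(j < p) q j) :=
  X^T *m \col_i g_tau tau (Y i 0 - (X *m b0) i 0).

Lemma gram_delta_min (v : 'cV[R]_(\sum_(j < p) q j)) :
  delta_min (gram X) * dotv v v * n%:R <= dotv (X *m v) (X *m v).
Proof.
have gE w : dotv w (gram X *m w) = n%:R^-1 * dotv (X *m w) (X *m w).
  by rewrite -scalemxAl dotvZr -mulmxA dotv_mull.
have [n0|n0] := posnP n.
  have -> : n%:R = 0 :> R by rewrite n0.
  by rewrite mulr0 dotv_ge0.
rewrite -ler_pdivlMr ?ltr0n// [leRHS]mulrC -gE delta_min_dotv//.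
- by rewrite /gram linearZ/= trmx_mul trmxK.
- by move=> w; rewrite gE mulr_ge0 ?dotv_ge0.
Qed.

(** Strong convexity summed over the observations: the quadratic part is bounded below through the
    Gram matrix, the linear part [dotv score (b - b0)] by Cauchy-Schwarz. *)
Lemma expectile_loss_growth (b : 'cV[R]_(\sum_(j < p) q j)) :
  0 <= kappa -> m0 <= delta_min (gram X) ->
  kappa * m0 * n%:R * norm2 (b - b0) ^+ 2 <=
    expectile_loss tau X Y b - expectile_loss tau X Y b0 +
    norm2 score * norm2 (b - b0).
Proof.
move=> k0 hm0; set dl := b - b0.
have conv : expectile_loss tau X Y b0 + dotv score dl +
    kappa * dotv (X *m dl) (X *m dl) <= expectile_loss tau X Y b.
  rewrite /score dotv_mull trmxK !dotvE mulr_sumr -!big_split/=.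
  apply: ler_sum => i _; rewrite mxE -expr2.
  have -> : Y i 0 - (X *m b) i 0 = Y i 0 - (X *m b0) i 0 - (X *m dl) i 0.
    by rewrite mulmxBr !mxE; ring.
  exact: rho_tau_convex.
have h1 : kappa * m0 * n%:R * norm2 dl ^+ 2 <= kappa * dotv (X *m dl) (X *m dl).
  rewrite -2!mulrA; apply: ler_wpM2l => //; apply: le_trans (gram_delta_min dl).
  by rewrite sqr_norm2 mulrCA mulrC ler_wpM2r// ler_wpM2r ?dotv_ge0.
have := cauchy_schwarz_dotv (- score) dl.
rewrite norm2N -scaleN1r dotvZl; lra.
Qed.

(** At a minimizer the loss difference in the growth bound is nonpositive; divide by the norm of
    [b - b0]. *)
Lemma expectile_argmin_bound (b : 'cV[R]_(\sum_(j < p) q j)) :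
  0 <= kappa -> m0 <= delta_min (gram X) ->
  is_argmin (expectile_loss tau X Y) b ->
  kappa * m0 * n%:R * norm2 (b - b0) <= norm2 score.
Proof.
move=> k0 hm0 /(_ b0) hb; have := expectile_loss_growth b k0 hm0.
have := norm2_ge0 (b - b0); rewrite le_eqVlt => /predU1P[<-|d0 h].
  by move=> _; rewrite mulr0 norm2_ge0.
by rewrite -(ler_pM2r d0) -[leLHS]mulrA -expr2; lra.
Qed.

(** Compare the objective at [b] and at [b0]. Inactive groups cost nothing at [b0], even under an
    infinite weight since [+oo * 0 = 0], and their nonnegative penalty at [b] is dropped. Active
    weights are finite, and the reverse triangle inequality bounds the difference of penalties by
    norms of [b - b0]. *)
Lemma adaptive_argmin_loss_le (A : pred 'I_p) (gamma lambda W : R)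
    (btilde b : 'cV[R]_(\sum_(j < p) q j)) :
  0 < lambda -> 
  (forall j, ~~ A j -> norm2 (submxcol b0 j) = 0) ->
  (forall j, A j -> norm2 (submxcol btilde j) != 0) ->
  (forall j, A j -> norm2 (submxcol btilde j) `^ (- gamma) <= W) ->
  is_argmin (adaptive_objective tau X Y gamma lambda btilde) b ->
  n%:R^-1 * (expectile_loss tau X Y b - expectile_loss tau X Y b0) <=
  lambda * W * \sum_(j | A j) norm2 (submxcol (b - b0) j).
Proof.
move=> l0 b00 bt0 hW /(_ b0).
pose w j := norm2 (submxcol btilde j) `^ (- gamma).
pose pen (b : 'cV_(\sum_(j < p) q j)) := \sum_(j | A j) w j * norm2 (submxcol b j).
have obj0 : adaptive_objective tau X Y gamma lambda btilde b0 =
    (n%:R^-1 * expectile_loss tau X Y b0 + lambda * pen b0)%:E.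
  rewrite /adaptive_objective EFinD [(lambda * _)%:E]EFinM; congr (_ + _ * _)%E.
  rewrite (bigID A)/= [X in (_ + X)%E]big1 ?adde0 => [|j jA]; last first.
    by rewrite b00// mule0.
  rewrite /pen -sumEFin; apply: eq_bigr => j jA.
  by rewrite /adaptive_weight (negbTE (bt0 j jA)).
have objb : ((n%:R^-1 * expectile_loss tau X Y b + lambda * pen b)%:E <=
    adaptive_objective tau X Y gamma lambda btilde b)%E.
  rewrite /adaptive_objective EFinD [(lambda * _)%:E]EFinM leeD2l// lee_pmul2l ?lte_fin//.
  rewrite [leRHS](bigID A)/= -[leLHS]adde0; apply: leeD.
    rewrite /pen -sumEFin; apply: lee_sum => j jA.
    by rewrite /adaptive_weight (negbTE (bt0 j jA)).
  apply: sume_ge0 => j _; apply: mule_ge0; last by rewrite lee_fin norm2_ge0.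
  by rewrite /adaptive_weight; case: ifP => // _; rewrite lee_fin powR_ge0.
rewrite obj0 => /(le_trans objb); rewrite lee_fin => h.
have hp : pen b0 - pen b <= W * \sum_(j | A j) norm2 (submxcol (b - b0) j).
  rewrite /pen -sumrB mulr_sumr; apply: ler_sum => j jA; rewrite -mulrBr.
  have w0 : 0 <= w j by exact: powR_ge0.
  rewrite submxcolB.
  apply: le_trans (_ : w j * norm2 (submxcol b j - submxcol b0 j) <= _).
    by rewrite ler_wpM2l// norm2_sub_le.
  by rewrite ler_wpM2r ?norm2_ge0// hW.
have := ler_wpM2l (ltW l0) hp; rewrite mulrA; lra.
Qed.

End design.
End loss.

(** * Independence and second moments *)

Section independence.
Context {d : measure_display} {T : measurableType d} {R : realType}.
Variable P : probability T R.
Local Open Scope ereal_scope.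

Definition independent_pair {d1 d2} {T1 : measurableType d1} {T2 : measurableType d2}
    (X : {RV P >-> T1}) (Y : {RV P >-> T2}) : Prop :=
  forall A B, measurable A -> measurable B ->
    P (X @^-1` A `&` Y @^-1` B) = P (X @^-1` A) * P (Y @^-1` B).

(** Independence speaks of rectangles, which determine the joint law as the product of the marginal
    laws; Fubini's theorem then applies. *)
Lemma integral_independent_pair d1 d2 (T1 : measurableType d1) (T2 : measurableType d2)
    (X : {RV P >-> T1}) (Y : {RV P >-> T2}) (h : T1 * T2 -> \bar R) :
  independent_pair X Y -> measurable_fun setT h ->
  P.-integrable setT (fun w => h (X w, Y w)) ->
  \int[P]_w h (X w, Y w) =
    \int[distribution P X]_x \int[distribution P Y]_y h (x, y).
Proof.
move=> ind mh ih.
pose Z w := (X w, Y w).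
have mZ : measurable_fun setT Z by exact: measurable_fun_pair.
pose Z' : {RV P >-> (T1 * T2)%type} := HB.pack Z (isMeasurableFun.Build _ _ _ _ _ mZ).
have joint A : measurable A ->
    (distribution P X \x distribution P Y) A = distribution P Z' A.
  by move=> mA; apply: product_measure_unique.
rewrite integral12_prod_meas1.
  rewrite (eq_measure_integral (distribution P Z')); last by move=> A mA _; exact: joint.
  by rewrite integral_distribution.
apply/integrableP; split => //.
rewrite (eq_measure_integral (distribution P Z')); last by move=> A mA _; exact: joint.
rewrite ge0_integral_distribution//; last exact: measurableT_comp.
by have /integrableP[] := ih.
Qed.

Lemma expectationM_independent (X Y : {RV P >-> R}) :
  independent_pair X Y ->
  (X : T -> R) \in Lfun P 1 -> (Y : T -> R) \in Lfun P 1 ->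
  (X \* Y)%R \in Lfun P 1 ->
  'E_P[(X \* Y)%R] = 'E_P[X] * 'E_P[Y].
Proof.
move=> ind X1 Y1 /Lfun1_integrable iXY.
pose h (z : R * R) : \bar R := (z.1 * z.2)%:E.
have mh : measurable_fun setT h.
  by apply/measurable_EFinP; apply: measurable_funM.
have -> : 'E_P[(X \* Y)%R] = \int[P]_w h (X w, Y w) by rewrite unlock.
rewrite (integral_independent_pair ind mh iXY).
have EE (W : {RV P >-> R}) : (W : T -> R) \in Lfun P 1 ->
    \int[distribution P W]_x x%:E = 'E_P[W].
  by move=> /Lfun1_integrable iW; rewrite integral_distribution// unlock.
have iE (W : {RV P >-> R}) : (W : T -> R) \in Lfun P 1 ->
    (distribution P W).-integrable setT EFin.
  by move=> /Lfun1_integrable iW; exact: integrable_pushforward.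
transitivity (\int[distribution P X]_x (x%:E * 'E_P[Y])).
  apply: eq_integral => x _; rewrite /h /=.
  under eq_integral do rewrite EFinM.
  by rewrite integralZl ?EE//; exact: iE.
have Yfin := expectation_fin_num Y1.
by rewrite -(fineK Yfin) integralZr ?EE//; exact: iE.
Qed.

End independence.

(** * Second moments of quadratic forms in pairwise independent variables *)

Section second_moments.
Context {d : measure_display} {T : measurableType d} {R : realType}.
Variable P : probability T R.

Lemma mutually_independent_pair (X : nat -> {RV P >-> R}) (f : R -> R)
    (Z : nat -> {RV P >-> R}) (i k : nat) :
  mutually_independent X -> measurable_fun setT f ->
  (forall i, Z i = f \o X i :> (T -> R)) -> i != k -> independent_pair (Z i) (Z k).
Proof.
move=> indX mf ZE ik A B mA mB.
(* The map [f] is absorbed into the events, so that independence of the [X i] can be used on the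
   index list [[:: i; k]]. *)
pose C j := if j == i then f @^-1` A else f @^-1` B.
have mC j : measurable (C j).
  by rewrite /C; case: ifP => _; rewrite -[X in measurable X]setTI; exact: mf.
have := indX [:: i; k] C; rewrite /= inE ik => /(_ erefl mC).
by rewrite !big_cons !big_nil setIT mule1 /C eqxx eq_sym (negbTE ik) !ZE.
Qed.

Section quadratic_form.
Variables (Z : nat -> {RV P >-> R}) (s : R).
Hypotheses (indZ : forall i k, i != k -> independent_pair (Z i) (Z k))
  (EZ : forall i, ('E_P[Z i] = 0)%E)
  (EZ2 : forall i, ('E_P[fun w => (Z i w ^+ 2)%R] = s%:E)%E).

Lemma integrable_sqr_RV i : P.-integrable setT (EFin \o (fun w => Z i w ^+ 2)).
Proof.
apply/integrableP; split.
  by apply/measurable_EFinP; exact: measurable_funX.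
under eq_integral => w _.
  rewrite /= ger0_norm ?sqr_ge0//; over.
by have := EZ2 i; rewrite unlock => ->; rewrite ltry.
Qed.

(** Domination by the sum of the two squares. *)
Lemma mul_RV_Lfun1 i k : (Z i \* Z k) \in Lfun P 1.
Proof.
apply/Lfun1_integrable.
apply: (@le_integrable _ _ _ P setT measurableT _
   ((EFin \o (fun w => Z i w ^+ 2)%R) \+ (EFin \o (fun w => Z k w ^+ 2)%R))%E).
- by apply/measurable_EFinP; exact: measurable_funM.
- move=> w _ /=; rewrite lee_fin.
  rewrite [leRHS]ger0_norm ?addr_ge0 ?sqr_ge0// normrM.
  rewrite -[in leRHS](real_normK (num_real (Z i w))) -[in leRHS](real_normK (num_real (Z k w))).
  have := sqr_ge0 (`|Z i w| - `|Z k w|).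
  have := normr_ge0 (Z i w); have := normr_ge0 (Z k w); nra.
- by apply: integrableD => //; exact: integrable_sqr_RV.
Qed.

Lemma RV_Lfun1 i : (Z i : T -> R) \in Lfun P 1.
Proof.
apply/Lfun1_integrable.
apply: (@le_integrable _ _ _ P setT measurableT _
   ((EFin \o cst 1%R) \+ (EFin \o (fun w => Z i w ^+ 2)%R))%E).
- exact/measurable_EFinP.
- move=> w _ /=; rewrite lee_fin.
  rewrite [leRHS]ger0_norm ?addr_ge0 ?sqr_ge0//.
  rewrite -[in leRHS](real_normK (num_real (Z i w))).
  have := sqr_ge0 (`|Z i w| - 1).
  have := normr_ge0 (Z i w); nra.
- apply: integrableD => //; last exact: integrable_sqr_RV.
  exact: finite_measure_integrable_cst.
Qed.

Lemma expectation_mul_RV i k :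
  ('E_P[(Z i \* Z k)%R] = if i == k then s%:E else 0)%E.
Proof.
case: eqP => [<-|/eqP ik].
  by rewrite -(EZ2 i); congr ('E_P[_])%E; apply/funext => w /=; rewrite expr2.
rewrite expectationM_independent ?EZ ?mule0//; [exact: indZ|exact: RV_Lfun1..|exact: mul_RV_Lfun1].
Qed.

(** Centring and pairwise independence kill the off-diagonal terms, which leaves [s] times the
    diagonal of [G]. *)
Lemma expectation_quadratic_form n (G : 'M[R]_n) :
  ('E_P[fun w => dotv (\col_(i < n) Z i w) (G *m \col_(i < n) Z i w)] =
    (s * \tr G)%:E)%E.
Proof.
have E w : (dotv (\col_(i < n) Z i w) (G *m \col_(i < n) Z i w))%:E =
    (\sum_(i < n) \sum_(k < n) (G i k)%:E * (EFin \o (Z i \* Z k)%R) w)%E.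
  rewrite dotvE -sumEFin; apply: eq_bigr => i _.
  rewrite !mxE mulr_sumr -sumEFin; apply: eq_bigr => k _.
  by rewrite !mxE -EFinM /=; congr EFin; ring.
have iE (i k : 'I_n) : P.-integrable setT (fun w => (G i k)%:E * (EFin \o (Z i \* Z k)%R) w)%E.
  by apply: integrableZl => //; apply/Lfun1_integrable; exact: mul_RV_Lfun1.
rewrite unlock; under eq_integral do rewrite E.
rewrite integral_sum//; last by move=> i; apply: integrable_sum.
rewrite /mxtrace mulr_sumr -sumEFin; apply: eq_bigr => i _.
rewrite integral_sum//.
under eq_bigr => k _.
  rewrite integralZl//; last by apply/Lfun1_integrable; exact: mul_RV_Lfun1.
  have -> : (\int[P]_w (EFin \o (Z i \* Z k)%R) w = 'E_P[(Z i \* Z k)%R])%E by rewrite unlock.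
  rewrite expectation_mul_RV; over.
rewrite (bigD1 i)//= eqxx big1 ?adde0 -?EFinM 1?mulrC// => k ki.
have /negbTE -> : (i != k :> nat) by rewrite eq_sym; exact: ki.
by rewrite mule0.
Qed.

Lemma measurable_quadratic_form n (G : 'M[R]_n) :
  measurable_fun setT (fun w => dotv (\col_(i < n) Z i w) (G *m \col_(i < n) Z i w)).
Proof.
have -> : (fun w => dotv (\col_(i < n) Z i w) (G *m \col_(i < n) Z i w)) =
    (fun w => \sum_(i < n) \sum_(k < n) G i k * (Z i \* Z k) w).
  apply/funext => w; rewrite dotvE; apply: eq_bigr => i _.
  rewrite !mxE mulr_sumr; apply: eq_bigr => k _.
  by rewrite !mxE /=; ring.
apply: measurable_sum => i; apply: measurable_sum => k.
by apply: measurable_funM => //; exact: measurable_funM.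
Qed.

End quadratic_form.

Lemma markov_gt (Q : T -> R) (m A : R) : 0 < A -> (forall w, 0 <= Q w) ->
  measurable_fun setT Q -> ('E_P[Q] = m%:E)%E ->
  (P [set w | (A < Q w)%R] <= (m / A)%:E)%E.
Proof.
move=> A0 Q0 mQ EQ.
have mQA (S : set R) : measurable S -> measurable (Q @^-1` S).
  by move=> mS; rewrite -[X in measurable X]setTI; exact: mQ.
pose Q' : {RV P >-> R} := HB.pack Q (isMeasurableFun.Build _ _ _ _ _ mQ).
have := @markov _ _ _ P Q' idfun A A0 (@measurable_id _ _ _).
have -> : idfun \o (fun x : R => `|x|) \o Q' = Q.
  by apply/funext => w /=; rewrite ger0_norm.
rewrite EQ => h.
rewrite EFinM lee_pdivlMr// muleC; apply: le_trans (h _ _) => //.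
rewrite lee_pmul2l ?lte_fin//; apply: le_measure; rewrite ?inE.
- rewrite [X in measurable X](_ : _ = Q @^-1` `]A, +oo[%classic); first exact: mQA.
  by apply/seteqP; split => w /=; rewrite in_itv/= andbT.
- rewrite [X in measurable X](_ : _ = Q @^-1` `[A, +oo[%classic); first exact: mQA.
  by apply/seteqP; split => w /=; rewrite in_itv/= andbT lee_fin ger0_norm.
- by move=> w /= /ltW; rewrite lee_fin ger0_norm.
Qed.

End second_moments.

(** * Measurability and growth of [g_tau] *)

Section expectile_score.
Context {R : realType}.
Variable tau : R.

Lemma g_tau_maxmin (e : R) : g_tau tau e =
  - 2 * (tau * Num.max e 0 + (1 - tau) * Num.min e 0).
Proof.
by rewrite /g_tau; case: (ltP e 0) => e0 /=; ring.
Qed.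

Lemma measurable_g_tau : measurable_fun setT (g_tau tau).
Proof.
rewrite (_ : g_tau tau = fun e => - 2 * (tau * Num.max e 0 + (1 - tau) * Num.min e 0)); last first.
  by apply/funext => e; exact: g_tau_maxmin.
apply: measurable_funM => //; apply: measurable_funD; apply: measurable_funM => //.
  exact: measurable_maxr.
exact: measurable_minr.
Qed.

(** Both slopes of [g_tau] are at most 2 in absolute value, and [4 * e ^+ 2 <= 2 + 2 * e ^+ 4]
    because [(e ^+ 2 - 1) ^+ 2] is nonnegative. The fourth moment of the errors thus controls the
    second moment of [g_tau]. *)
Lemma sqr_g_tau_le (e : R) : 0 < tau < 1 -> g_tau tau e ^+ 2 <= 2 + 2 * e ^+ 4.
Proof.
move=> /andP[t0 t1]; apply: (@le_trans _ _ (4 * e ^+ 2)); last first.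
  have -> : e ^+ 4 = e ^+ 2 * e ^+ 2 by ring.
  have := sqr_ge0 (e ^+ 2 - 1); nra.
have e2 := sqr_ge0 e.
rewrite /g_tau; case: (ltP e 0) => e0 /=.
  rewrite mulr0 mulr1 add0r; have : (1 - tau) ^+ 2 <= 1 by nra.
  by nra.
rewrite mulr1 mulr0 addr0; have : tau ^+ 2 <= 1 by nra.
by nra.
Qed.

End expectile_score.

(** * The adaptive group LASSO estimator *)

Section adaptive_bound.
Context {R : realType} {n p : nat} {q : 'I_p -> nat}.
Variables (tau kappa : R).
Hypotheses (htau : 0 < tau < 1) (kappa_le : kappa <= tau) (kappa_le' : kappa <= 1 - tau).
Variables (X : 'M[R]_(n, \sum_(j < p) q j)) (Y : 'cV[R]_n).
Variables (m0 : R) (b0 : 'cV[R]_(\sum_(j < p) q j)).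

(** The deterministic core. The condition on [a] puts the expectile estimator within [H / 2] of
    [b0]; active groups, of norm at least [H] in [b0], keep norm at least [H / 2], so their weights
    are at most that of [H / 2]. The growth bound and the objective comparison then combine, divided
    by [n] and by the norm of [b - b0]. *)
Lemma adaptive_argmin_bound (A : pred 'I_p) (gamma lambda H a : R)
    (btilde b : 'cV[R]_(\sum_(j < p) q j)) :
  (0 < n)%N -> 0 < kappa -> 0 < m0 -> m0 <= delta_min (gram X) ->
  0 < lambda -> 0 < gamma -> 0 < H ->
  norm2 (score tau X Y b0) <= a * n%:R -> a <= kappa * m0 * (H / 2) ->
  (forall j, ~~ A j -> norm2 (submxcol b0 j) = 0) ->
  (forall j, A j -> H <= norm2 (submxcol b0 j)) ->
  is_argmin (expectile_loss tau X Y) btilde ->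
  is_argmin (adaptive_objective tau X Y gamma lambda btilde) b ->
  kappa * m0 * norm2 (b - b0) <= a + lambda * (H / 2) `^ (- gamma) * Num.sqrt p%:R.
Proof.
move=> n0 k0 m00 hm0 l0 g0 H0 sa aH bA bH tmin bmin.
have nR0 : 0 < n%:R :> R by rewrite ltr0n.
have km0 : 0 < kappa * m0 by rewrite mulr_gt0.
have H20 : 0 < H / 2 by rewrite divr_gt0.
have td : norm2 (btilde - b0) <= H / 2.
  have := expectile_argmin_bound htau kappa_le kappa_le' b0 (ltW k0) hm0 tmin.
  move=> /le_trans/(_ sa); rewrite mulrAC ler_pM2r// => h.
  by rewrite -(ler_pM2l km0) (le_trans h).
have tH j : A j -> H / 2 <= norm2 (submxcol btilde j).
  move=> /bH hj; have := norm2_sub_le (submxcol b0 j) (submxcol btilde j).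
  rewrite -submxcolB; have := norm2_submxcol_le (btilde - b0) j; lra.
have tW j : A j -> norm2 (submxcol btilde j) `^ (- gamma) <= (H / 2) `^ (- gamma).
  move=> jA; rewrite !powRN lef_pV2 ?posrE ?powR_gt0//; last exact: lt_le_trans (tH j jA).
  by rewrite ge0_ler_powR ?nnegrE ?norm2_ge0 ?tH// ltW.
have tn0 j : A j -> norm2 (submxcol btilde j) != 0.
  by move=> jA; rewrite gt_eqF// (lt_le_trans H20) ?tH.
have := adaptive_argmin_loss_le l0 bA tn0 tW bmin.
have := expectile_loss_growth htau kappa_le kappa_le' Y b0 b (ltW k0) hm0.
set D := _ - expectile_loss tau X Y b0; set S := score tau X Y b0.
have := norm2_ge0 (b - b0); rewrite le_eqVlt => /predU1P[<- _ _|d0 h1 h2].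
  rewrite mulr0 addr_ge0 ?mulr_ge0 ?powR_ge0 ?sqrtr_ge0 ?(ltW l0)//.
  (* Nonnegativity of [a] comes from the bound [sa] on a norm. *)
  by rewrite -(pmulr_lge0 _ nR0) (le_trans _ sa) ?norm2_ge0.
have {}h2 : n%:R^-1 * D <= lambda * (H / 2) `^ (- gamma) * Num.sqrt p%:R * norm2 (b - b0).
  apply: (le_trans h2); rewrite -[leRHS]mulrA; apply: ler_wpM2l.
    by rewrite mulr_ge0 ?powR_ge0// ltW.
  exact: sum_norm2_submxcol_le.
rewrite -(ler_pM2r d0) -(ler_pM2r nR0).
have {}h2 : D <= lambda * (H / 2) `^ (- gamma) * Num.sqrt p%:R * norm2 (b - b0) * n%:R.
  by rewrite -ler_pdivrMr// mulrC.
have h3 := ler_wpM2r (norm2_ge0 (b - b0)) sa.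
by rewrite -/S in h3; lra.
Qed.

End adaptive_bound.

(** * Second moment of the score *)

Lemma mxtrace_mul_trmx_le (R : realType) n m (X : 'M[R]_(n, m)) (C : R) :
  (forall i, `|row i X| <= C) -> \tr (X *m X^T) <= n%:R * m%:R * C ^+ 2.
Proof.
move=> hC; rewrite /mxtrace.
have -> : n%:R * m%:R * C ^+ 2 = \sum_(i < n) \sum_(j < m) C ^+ 2.
  by rewrite sumr_const card_ord sumr_const card_ord -mulrA mulr_natl mulr_natl.
apply: ler_sum => i _; rewrite mxE; apply: ler_sum => j _.
rewrite mxE -expr2 -real_normK ?num_real//.
have : `|X i j| <= C; last by have := normr_ge0 (X i j); nra.
apply: le_trans (hC i); have -> : X i j = row i X 0 j by rewrite mxE.
rewrite [leRHS]/Num.Def.normr/= mx_normrE.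
exact: (le_bigmax _ (fun k => `|row i X k.1 k.2|) (0, j)).
Qed.

Section score_moment.
Context {d : measure_display} {T : measurableType d} {R : realType}.
Variables (P : probability T R) (eps : nat -> {RV P >-> R}) (tau : R).
Hypotheses (htau : 0 < tau < 1) (hindep : mutually_independent eps)
  (hid : identically_distributed eps)
  (hexpectile : forall i, ('E_P[fun w => g_tau tau (eps i w)] = 0)%E)
  (hmoment : forall i, ('E_P[fun w => (eps i w ^+ 4)%R] < +oo)%E).

(** The constant [s] is the common second moment of the [g_tau tau (eps i)], and the squared norm is
    the quadratic form of matrix [X *m X^T] in them. It is chosen before [n] and the design, which
    makes the final bound uniform. *)
Lemma score_second_moment : exists2 s : R, 0 <= s &
  forall n m (X : 'M[R]_(n, m)),
    let Q w := norm2 (X^T *m \col_(i < n) g_tau tau (eps i w)) ^+ 2 in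
    measurable_fun setT Q /\ ('E_P[Q] = (s * \tr (X *m X^T))%:E)%E.
Proof.
have mZ i : measurable_fun setT (g_tau tau \o eps i).
  by apply: measurableT_comp => //; exact: measurable_g_tau.
pose Z i : {RV P >-> R} := HB.pack (g_tau tau \o eps i) (isMeasurableFun.Build _ _ _ _ _ (mZ i)).
have mg2 : measurable_fun setT (fun x : R => (g_tau tau x ^+ 2)%:E).
  by apply/measurable_EFinP; apply: measurable_funX; exact: measurable_g_tau.
(* As an integral against the law of [eps i], the second moment is the same for all indices. *)
have Z2E i : ('E_P[fun w => (Z i w ^+ 2)%R] =
    \int[distribution P (eps i)]_x (g_tau tau x ^+ 2)%:E)%E.
  rewrite ge0_integral_distribution//; first by rewrite unlock.
  by move=> y; rewrite lee_fin sqr_ge0.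
have fin0 : ('E_P[fun w => (Z 0%N w ^+ 2)%R] \is a fin_num)%E.
  rewrite ge0_fin_numE; last by apply: expectation_ge0 => w; exact: sqr_ge0.
  apply: (@le_lt_trans _ _ 'E_P[(fun w => 2 + 2 * eps 0%N w ^+ 4)%R]%E).
    apply: expectation_le => //.
    - by apply: measurable_funX; exact: mZ.
    - apply: measurable_funD => //; apply: measurable_funM => //.
      exact: measurable_funX.
    - by move=> w; exact: sqr_ge0.
    - by move=> w; rewrite addr_ge0// mulr_ge0// -[4%N]/(2 * 2)%N exprM sqr_ge0.
    - by apply/aeW => w; exact: sqr_g_tau_le.
  have i4 : P.-integrable setT (EFin \o (fun w => eps 0%N w ^+ 4)).
    apply/integrableP; split; first by apply/measurable_EFinP; exact: measurable_funX.
    under eq_integral => w _.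
      rewrite /= ger0_norm ?(exprM _ 2 2) ?sqr_ge0//; over.
    have := hmoment 0%N; rewrite unlock.
    by under [X in (X < _)%E -> _]eq_integral do rewrite (exprM _ 2 2).
  rewrite unlock; apply: integrable_lty => //.
  apply: (@integrableD _ _ _ P setT measurableT (EFin \o cst 2)
     (fun w => 2%:E * (EFin \o (fun w => eps 0%N w ^+ 4)%R) w)%E).
    exact: finite_measure_integrable_cst.
  exact: integrableZl.
pose s := fine ('E_P[fun w => (Z 0%N w ^+ 2)%R])%E.
have EZ2 i : ('E_P[fun w => (Z i w ^+ 2)%R] = s%:E)%E.
  rewrite fineK// !Z2E; apply: eq_measure_integral => A mA _; exact: hid.
have indZ i k : i != k -> independent_pair (Z i) (Z k).
  by apply: (mutually_independent_pair hindep (measurable_g_tau tau)).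
exists s; first by apply/fine_ge0/expectation_ge0 => w; exact: sqr_ge0.
move=> n m X /=.
have QE : (fun w => norm2 (X^T *m \col_(i < n) g_tau tau (eps i w)) ^+ 2) =
    fun w => dotv (\col_(i < n) Z i w) ((X *m X^T) *m \col_(i < n) Z i w).
  by apply/funext => w; rewrite sqr_norm2 dotv_mull trmxK mulmxA.
rewrite QE; split; first exact: measurable_quadratic_form.
exact: expectation_quadratic_form.
Qed.

End score_moment.

(** * From the deterministic bound to the rate in probability *)

Lemma powR_eventually_ge (R : realType) (M eta : R) : 0 < eta ->
  \forall n \near \oo, M <= n%:R `^ eta.
Proof.
move=> eta0; near=> n.
have : `|M| `^ eta^-1 <= n%:R by near: n; exact: nbhs_infty_ger.
move=> /(@ge0_ler_powR _ eta (ltW eta0)).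
rewrite !nnegrE powR_ge0 ler0n -powRrM mulVf ?gt_eqF// powRr1// => /(_ isT isT).
by apply: le_trans; exact: ler_norm.
Unshelve. all: by end_near. Qed.

Lemma measurable_norm2_gt (d : measure_display) (T : measurableType d)
    (R : realType) m (v : T -> 'cV[R]_m) (a : R) : 0 <= a ->
  (forall i, measurable_fun setT (fun w => v w i 0)) ->
  measurable [set w | a < norm2 (v w)].
Proof.
move=> a0 mv.
pose Q w := \sum_(i < m) v w i 0 ^+ 2.
have mQ : measurable_fun setT Q.
  by apply: measurable_sum => i; exact: measurable_funX.
rewrite (_ : [set w | _] = setT `&` Q @^-1` `]a ^+ 2, +oo[%classic); first exact: mQ.
have QE w : Q w = norm2 (v w) ^+ 2.
  by rewrite sqr_sqrtr// sumr_ge0// => i _; exact: sqr_ge0.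
by rewrite setTI; apply/seteqP; split => w /=;
  rewrite in_itv/= andbT QE ltr_sqr ?nnegrE ?norm2_ge0.
Qed.

Theorem theorem3p3
  (R : realType) (d : measure_display) (T : measurableType d)
  (P : probability T R)
  (p p0 : nat -> nat) (q : forall n : nat, 'I_(p n) -> nat)
  (X : forall n : nat, 'M[R]_(n, \sum_(j < p n) q n j))
  (beta0 : forall n : nat, 'cV[R]_(\sum_(j < p n) q n j))
  (eps : nat -> {RV P >-> R})
  (Y : forall n : nat, T -> 'cV[R]_n)
  (hY : forall n w, Y n w = X n *m beta0 n + \col_(i < n) eps i w)
  (hp0 : forall n, (p0 n <= p n)%N)
  (hbeta0 : forall n (j : 'I_(p n)),
    (norm2 (submxcol (beta0 n) j) != 0) = (j < p0 n)%N)
  (* group sizes are O(1) on average, i.e. r = O(p) *)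
  (hq : exists D : nat,
    \forall n \near \oo, (\sum_(j < p n) q n j <= D * p n)%N)
  (tau gamma : R) (htau : 0 < tau < 1) (hgamma : 0 < gamma)
  (lambda : nat -> R) (hlambda : forall n, 0 < lambda n)
  (betatilde betahat : forall n : nat, T -> 'cV[R]_(\sum_(j < p n) q n j))
  (hbetatilde : forall n w,
    is_argmin (expectile_loss tau (X n) (Y n w)) (betatilde n w))
  (hbetahat : forall n w,
    is_argmin (adaptive_objective tau (X n) (Y n w) gamma (lambda n)
                 (betatilde n w)) (betahat n w))
  (mbetahat : forall n i, measurable_fun setT (fun w => betahat n w i 0))
  (hindep : mutually_independent eps)
  (hid : identically_distributed eps)
  (hexpectile : forall i, ('E_P[fun w => g_tau tau (eps i w)] = 0)%E)
  (hdensity : exists f : R -> R,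
    [/\ forall i, has_density (eps i) f, forall x, 0 < f x
      & \forall x \near (0 : R), {for x, continuous f}])
  (hmoment : forall i, ('E_P[fun w => (eps i w ^+ 4)%R] < +oo)%E)
  (* the norm is the sup norm *)
  (hA2 : exists2 C0 : R, 0 < C0 &
    \forall n \near \oo, forall i : 'I_n, `|row i (X n)| <= C0)
  (hA3 : exists m0 M0 : R, 0 < m0 <= M0 /\
    \forall n \near \oo,
      [/\ m0 <= delta_min (gram (X n)),
          delta_min (gram (X n)) <= delta_max (gram (X n))
        & delta_max (gram (X n)) <= M0])
  (c : R) (hc : 0 <= c < 1 / 2)
  (hA4 : exists B : R, \forall n \near \oo, (p n)%:R <= B * n%:R `^ c)
  (alpha : R) (halpha : (c - 1) / 2 < alpha)
  (hA5 : exists2 K : R, 0 < K &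
    \forall n \near \oo,
      (K%:E <= (n%:R `^ (- alpha))%:E * min_signal (p0 n) (beta0 n))%E)
  (hlambda0 : lambda n @[n --> \oo] --> (0 : R))
  (hlambda1 : lambda n * n%:R `^ (1 / 2 - alpha * gamma) @[n --> \oo]
                --> (0 : R)) :
  stochastic_bigO P (fun n w => norm2 (betahat n w - beta0 n))
    (fun n => ((p n)%:R / n%:R) `^ (1 / 2)).
Proof.
have [D hD] := hq; have [C0 C00 hC0] := hA2.
have [m0 [M0 [/andP[m00 _] hm]]] := hA3; have [B hB] := hA4; have [K K0 hK] := hA5.
have [s s0 hs] := score_second_moment htau hindep hid hexpectile hmoment.
pose kappa := Num.min tau (1 - tau).
have kappa_le : kappa <= tau by rewrite /kappa ge_min lexx.
have kappa_le' : kappa <= 1 - tau by rewrite /kappa ge_min lexx orbT.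
have kappa0 : 0 < kappa.
  by have /andP[t0 t1] := htau; rewrite /kappa lt_min t0 subr_gt0.
have km0 : 0 < kappa * m0 by rewrite mulr_gt0.
move=> e e0.
(* Markov's inequality will bound the probability that the squared score exceeds [A * n * p] by
   [s * D * C0 ^+ 2 / A]; the summand 1 makes this strictly less than [e] and [A] positive. *)
pose A := s * D%:R * C0 ^+ 2 / e + 1.
have A0 : 0 < A.
  by rewrite ltr_wpDl// divr_ge0 ?(ltW e0)// !mulr_ge0// ?sqr_ge0 ?ler0n// ltW.
have Ae : s * D%:R * C0 ^+ 2 < A * e.
  by rewrite /A mulrDl divfK ?gt_eqF// mul1r ltrDl.
(* In units of [sqrt (p / n)], the score contributes [sqrt A] and the penalty 1. *)
pose C := (Num.sqrt A + 1) / (kappa * m0).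
have C_gt0 : 0 < C by rewrite divr_gt0// ltr_wpDl ?sqrtr_ge0.
exists C => //.
pose E := (kappa * m0 * (K / 2)) ^+ 2.
have E0 : 0 < E by rewrite exprn_gt0// mulr_gt0// divr_gt0.
have eta0 : 0 < 2 * alpha + 1 - c by move: halpha; lra.
have Kg0 : 0 < (K / 2) `^ gamma by rewrite powR_gt0// divr_gt0.
have small : \forall n \near \oo,
    lambda n * n%:R `^ (1 / 2 - alpha * gamma) <= (K / 2) `^ gamma.
  have /cvgrPdist_le/(_ _ Kg0) := hlambda1.
  apply: filterS => n; rewrite sub0r normrN; exact: le_trans (ler_norm _).
(* Since [p <= B * n ^ c], this gives [A * p <= E * n ^ (2 * alpha + 1)], the squared form of the
   requirement [aH] that the expectile error be at most half the signal. The lower bound on [alpha]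
   is what makes the exponent positive. *)
have rate := powR_eventually_ge (A * B / E) eta0.
near=> n.
have n0 : (0 < n)%N by near: n; exact: nbhs_infty_gt.
have nR0 : 0 < n%:R :> R by rewrite ltr0n.
have hDn : (\sum_(j < p n) q n j <= D * p n)%N by near: n.
have hCn : forall i : 'I_n, `|row i (X n)| <= C0 by near: n.
have [hmn _ _] : [/\ m0 <= delta_min (gram (X n)),
   delta_min (gram (X n)) <= delta_max (gram (X n)) & delta_max (gram (X n)) <= M0].
  by near: n.
have hBn : (p n)%:R <= B * n%:R `^ c by near: n.
have hKn : (K%:E <= (n%:R `^ (- alpha))%:E * min_signal (p0 n) (beta0 n))%E by near: n.
have smalln : lambda n * n%:R `^ (1 / 2 - alpha * gamma) <= (K / 2) `^ gamma by near: n.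
have raten : A * B / E <= n%:R `^ (2 * alpha + 1 - c) by near: n.
set u := _ `^ (1 / 2).
have uE : u = Num.sqrt ((p n)%:R / n%:R) by rewrite /u mul1r powR12_sqrt// divr_ge0.
have u0 : 0 <= u by exact: powR_ge0.
rewrite (ger0_norm u0).
rewrite (_ : [set w | _] = [set w | C * u < norm2 (betahat n w - beta0 n)]); last first.
  by apply/funext => w /=; rewrite ger0_norm ?norm2_ge0.
(* Without groups the threshold [A * n * p] would be 0, which Markov's inequality excludes; but then
   the error vanishes and the event is empty. *)
have [pn0|pn0] := posnP (p n).
  rewrite (_ : [set w | _] = set0) ?measure0//; apply/seteqP; split => // w /=.
  suff -> : norm2 (betahat n w - beta0 n) = 0 by rewrite ltNge mulr_ge0// ltW.
  apply/eqP; rewrite -sqrf_eq0 -sum_sqr_norm2_submxcol big1// => j.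
  by have := ltn_ord j; rewrite {2}pn0.
have pR0 : 0 < (p n)%:R :> R by rewrite ltr0n.
have uu : u ^+ 2 * n%:R = (p n)%:R by rewrite uE sqr_sqrtr ?divr_ge0// divfK ?gt_eqF.
pose Q w := norm2 ((X n)^T *m \col_(i < n) g_tau tau (eps i w)) ^+ 2.
have [mQ EQ] := hs _ _ (X n).
have scoreE w : score tau (X n) (Y n w) (beta0 n) = (X n)^T *m \col_(i < n) g_tau tau (eps i w).
  rewrite /score hY; congr (_ *m _); apply/colP => i; rewrite !mxE.
  by congr g_tau; rewrite addrAC subrr add0r.
pose H := K * n%:R `^ alpha.
have H0 : 0 < H by rewrite mulr_gt0// powR_gt0.
have powD a b : n%:R `^ (a + b) = n%:R `^ a * n%:R `^ b :> R.
  by rewrite powRD// (gt_eqF nR0) implybT.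
have aH : Num.sqrt A * u <= kappa * m0 * (H / 2).
  have HE : (kappa * m0 * (H / 2)) ^+ 2 * n%:R =
      n%:R `^ (2 * alpha + 1 - c) * E * n%:R `^ c.
    have -> : 2 * alpha + 1 - c = alpha + alpha + 1 - c by ring.
    rewrite powD powD powD powRN powRr1// /E /H.
    by field; rewrite gt_eqF// powR_gt0.
  rewrite -ler_sqr ?nnegrE ?mulr_ge0 ?sqrtr_ge0 ?divr_ge0// ?(ltW kappa0) ?(ltW m00) ?(ltW K0)//.
  rewrite exprMn sqr_sqrtr ?(ltW A0)// -(ler_pM2r nR0) HE -[leLHS]mulrA uu.
  apply: (@le_trans _ _ (A * B * n%:R `^ c)); first by rewrite -mulrA ler_pM2l.
  by rewrite ler_wpM2r ?powR_ge0// -ler_pdivrMr.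
(* Writing [sqrt p] as [u * n ^ (1 / 2)] and factoring [n ^ (- alpha * gamma)] out of the weight
   leaves [u] times the quantity made small by the second condition on [lambda]. *)
have pen : lambda n * (H / 2) `^ (- gamma) * Num.sqrt (p n)%:R <= u.
  have -> : Num.sqrt (p n)%:R = u * n%:R `^ (1 / 2).
    by rewrite uE mul1r powR12_sqrt// -sqrtrM ?divr_ge0// divfK// gt_eqF.
  have -> : (H / 2) `^ (- gamma) = ((K / 2) `^ gamma)^-1 * n%:R `^ (- (alpha * gamma)).
    have K20 : 0 <= K / 2 by rewrite divr_ge0// ltW.
    rewrite /H mulrAC [LHS]powRM ?powR_ge0// [(K / 2) `^ (- gamma)]powRN; congr (_ * _).
    by rewrite -powRrM mulrN.
  rewrite (_ : _ * _ * _ = u * (((K / 2) `^ gamma)^-1 *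
      (lambda n * n%:R `^ (1 / 2 - alpha * gamma)))); last by rewrite powD; ring.
  by rewrite -[leRHS]mulr1 ler_wpM2l// [leLHS]mulrC ler_pdivrMr// [leRHS]mul1r.
have bA (j : 'I_(p n)) : ~~ (j < p0 n)%N -> norm2 (submxcol (beta0 n) j) = 0.
  by rewrite -hbeta0 negbK => /eqP.
have bH (j : 'I_(p n)) : (j < p0 n)%N -> H <= norm2 (submxcol (beta0 n) j).
  move=> jp0; rewrite /H -ler_pdivlMr ?powR_gt0// -powRN mulrC -lee_fin EFinM.
  apply: (le_trans hKn); rewrite lee_pmul2l ?lte_fin ?powR_gt0//.
  exact: (bigmin_le_cond +oo%E (fun j => (norm2 (submxcol (beta0 n) j))%:E) jp0).
have incl : [set w | C * u < norm2 (betahat n w - beta0 n)] `<=`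
    [set w | A * (n%:R * (p n)%:R) < Q w].
  move=> w /=; apply: contraTT; rewrite -!leNgt => Qw.
  (* By contraposition the score is small, and [sqrt (A * n * p)] equals [sqrt A * u * n], so the
     deterministic bound applies with [a = sqrt A * u]. *)
  have sw : norm2 (score tau (X n) (Y n w) (beta0 n)) <= Num.sqrt A * u * n%:R.
    rewrite scoreE -ler_sqr ?nnegrE ?norm2_ge0 ?mulr_ge0 ?sqrtr_ge0//.
    apply: (le_trans Qw); rewrite !exprMn sqr_sqrtr ?(ltW A0)// -uu.
    by rewrite expr2; lra.
  have := adaptive_argmin_bound htau kappa_le kappa_le' n0 kappa0 m00 hmn (hlambda n)
    hgamma H0 sw aH bA bH (hbetatilde n w) (hbetahat n w).
  rewrite /C => h; rewrite mulrAC ler_pdivlMr// mulrC; apply: (le_trans h).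
  by rewrite mulrDl mul1r lerD2l.
have mQA : measurable [set w | A * (n%:R * (p n)%:R) < Q w].
  rewrite (_ : [set w | _] = setT `&` Q @^-1` `]A * (n%:R * (p n)%:R), +oo[%classic).
    exact: mQ.
  by rewrite setTI; apply/seteqP; split => w /=; rewrite in_itv/= andbT.
have np0 : 0 < A * (n%:R * (p n)%:R) by rewrite !mulr_gt0.
apply: (@le_lt_trans _ _ (P [set w | A * (n%:R * (p n)%:R) < Q w])).
  apply: le_measure => //; rewrite ?inE//.
  apply: measurable_norm2_gt; first by rewrite mulr_ge0// ltW.
  move=> i; rewrite (_ : (fun w => _) = (fun w => betahat n w i 0 - beta0 n i 0)).
    by apply: measurable_funB => //; exact: mbetahat.
  by apply/funext => w; rewrite !mxE.
apply: le_lt_trans (markov_gt np0 (fun w => sqr_ge0 _) mQ EQ) _.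
rewrite lte_fin ltr_pdivrMr//.
(* The trace is at most [n * r * C0 ^+ 2]; the bound [r <= D * p] on the total dimension turns it
   into a multiple of [n * p], which cancels against the threshold. *)
have tr := mxtrace_mul_trmx_le hCn.
apply: (@le_lt_trans _ _ (s * (n%:R * (D%:R * (p n)%:R) * C0 ^+ 2))).
  apply: ler_wpM2l => //; apply: (le_trans tr).
  by rewrite ler_wpM2r ?sqr_ge0// ler_wpM2l// -natrM ler_nat.
rewrite (_ : s * _ = s * D%:R * C0 ^+ 2 * (n%:R * (p n)%:R)); last by ring.
by rewrite [ltRHS]mulrA (mulrC e) ltr_pM2r// mulr_gt0.
Unshelve. all: by end_near. Qed.
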